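(* Let $n\ge0$ and let $H_n$ be the pyrene system with $n$ pyrene fragments. Then $$IDF(H_n)=\frac{\sqrt{2}}{32}(3-2\sqrt{2})^n+\frac{7-5\sqrt{2}}{8}n(3-2\sqrt{2})^n-\frac{\sqrt{2}}{32}(3+2\sqrt{2})^n+\frac{7+5\sqrt{2}}{8}n(3+2\sqrt{2})^n.$$
   Context: Pyrene system: draw the hexagonal lattice so that every hexagon has two vertical sides; horizontally adjacent hexagons then share a vertical edge. For $n\ge1$, $H_n$ is the hexagonal system (the plane graph formed by the vertices and edges of the following $4n$ hexagons) consisting of a horizontal linear row of $2n$ hexagons $h_{1,1},h_{1,2},\dots,h_{n,1},h_{n,2}$, consecutive ones sharing a vertical edge, together with, for each $i$, a hexagon $s_{i,1}$ directly above and a hexagon $s_{i,2}$ directly below the common edge of $h_{i,1}$ and $h_{i,2}$ (each sharing an edge with both $h_{i,1}$ and $h_{i,2}$). $H_0$ is the null graph, which has exactly one (empty) perfect matching with forcing number $0$. For a perfect matching $M$ of $G$, a forcing set is a subset $S\subseteq M$ contained in no other perfect matching of $G$, and the forcing number $f(G,M)$ is the minimum size of a forcing set. The degree of freedom $IDF(G)$ is $\sum_{M}f(G,M)$, summed over all perfect matchings $M$ of $G$. *)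

(* Defs.v *)
From mathcomp Require Import all_boot all_order all_algebra.
Set Implicit Arguments. Unset Strict Implicit. Unset Printing Implicit Defensive.

(* Hexagonal lattice drawn as a "brick wall": vertices are integer points
   (x, y); a hexagon with lower-left corner (a, b) has vertices
   (a,b),(a+1,b),(a+2,b),(a,b+1),(a+1,b+1),(a+2,b+1); its two vertical sides
   are {(a,b),(a,b+1)} and {(a+2,b),(a+2,b+1)}; the other four sides are
   {(a,b),(a+1,b)}, {(a+1,b),(a+2,b)} and the same at height b+1.
   Horizontally adjacent hexagons (a,b),(a+2,b) share a vertical edge, and the
   hexagon (a+1,b+1) (resp. (a+1,b-1)) lies directly above (resp. below) the
   common edge of these two hexagons. Heights are shifted by +1 so that all
   coordinates are natural numbers. *)

(* The hexagons of H_n: the row h_{1,1},...,h_{n,2} at corners (2k,1),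
   k < 2n (h_{i,1} = (4i,1), h_{i,2} = (4i+2,1) for i < n, 0-based), and
   s_{i,1} = (4i+1,2) above, s_{i,2} = (4i+1,0) below the common edge
   x = 4i+2 of h_{i,1} and h_{i,2}. *)
Definition pyrene_hexagons (n : nat) : seq (nat * nat) :=
  [seq (2 * k, 1) | k <- iota 0 (2 * n)] ++
  [seq (4 * i + 1, 2) | i <- iota 0 n] ++
  [seq (4 * i + 1, 0) | i <- iota 0 n].

Definition hex_side (h : nat * nat) (p q : nat * nat) : bool :=
  let: (a, b) := h in let: (x1, y1) := p in let: (x2, y2) := q in
  [&& y1 == y2, (y1 == b) || (y1 == b.+1), a <= minn x1 x2,
      maxn x1 x2 <= a + 2 & (x1.+1 == x2) || (x2.+1 == x1)]
  || [&& x1 == x2, (x1 == a) || (x1 == a + 2) &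
        ((y1 == b) && (y2 == b.+1)) || ((y2 == b) && (y1 == b.+1))].

(* All coordinates of H_n satisfy x <= 4n and y <= 3. *)
Definition vtx (n : nat) : finType := ('I_(4 * n + 1) * 'I_4)%type.

Definition coord n (v : vtx n) : nat * nat := (val v.1, val v.2).

Definition adj n (u v : vtx n) : bool :=
  has (fun h => hex_side h (coord u) (coord v)) (pyrene_hexagons n).

Definition pyr_edges (n : nat) : {set {set vtx n}} :=
  [set e : {set vtx n} |
     [exists u : vtx n, exists v : vtx n, adj u v && (e == [set u; v])]].

Definition pyr_vertices (n : nat) : {set vtx n} :=
  [set v | [exists e in pyr_edges n, v \in e]].

Definition perfect_matching n (M : {set {set vtx n}}) : bool :=
  (M \subset pyr_edges n) &&
  [forall v in pyr_vertices n, #|[set e in M | v \in e]| == 1].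

Definition forcing_set n (M S : {set {set vtx n}}) : bool :=
  (S \subset M) &&
  [forall M' : {set {set vtx n}},
     (perfect_matching M' && (S \subset M')) ==> (M' == M)].

(* Forcing number: minimum size of a forcing set (M itself is one). *)
Definition forcing_number n (M : {set {set vtx n}}) : nat :=
  \big[minn/#|M|]_(S in powerset M | forcing_set M S) #|S|.

Definition IDF (n : nat) : nat :=
  \sum_(M : {set {set vtx n}} | perfect_matching M) forcing_number M.

(* Main.v *)
Require Import Defs.
From mathcomp Require Import all_boot all_order all_algebra.
From mathcomp Require Import zify ring.
Set Implicit Arguments. Unset Strict Implicit. Unset Printing Implicit Defensive.

(** In each fragment, the two outermost rows force exactly one of the odd columns [4i+1], [4i+3] of
    each of the rows [y = 1] and [y = 2] to be matched inside that row, to a neighbour in column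
    [4i], [4i+2] or [4i+4].  The even columns carry the rungs between the two rows, and a
    sweep from left to right shows that both rows use the same even column.  So a perfect matching is a
    word of length [n] over six letters: A (column [4i]), C (column [4i+4]) and four letters B
    (column [4i+2], with an independent choice of odd column in each row), subject only to the
    factor CA being forbidden.

    The letter of a fragment can always be replaced by a B letter, and one coordinate of a B letter
    can always be flipped.  Such a change removes only matching edges lying inside the fragment
    (on one side of it, for a flip), so a forcing set has at least one edge in a fragment A or C
    and two in a fragment B; this many suffice.  Writing [P n] for the number of words and [Q n]
    for their total cost, this gives [P (n+2) = 6 P (n+1) - P n] and
    [Q (n+2) = 6 Q (n+1) + 10 P (n+1) - Q n - 2 P n]. *)

Local Notation coord := Defs.coord.

(** * Edges and perfect matchings in coordinates *)

(* The code [(d, p)] stands for the edge from [p] to its right neighbour if [d] holds, and from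
   [p] to the point above it otherwise. *)
Definition code := (bool * (nat * nat))%type.

Definition far_end (c : code) : nat * nat :=
  if c.1 then (c.2.1.+1, c.2.2) else (c.2.1, c.2.2.+1).

Definition is_code n (c : code) : bool :=
  let: (d, (x, y)) := c in
  if d then
    (x < 4 * n) &&
    [|| y == 1, y == 2 | ((y == 0) || (y == 3)) && ((x %% 4 == 1) || (x %% 4 == 2))]
  else [&& 0 < n, x <= 4 * n & (y == 1) && ~~ odd x || ((y == 0) || (y == 2)) && odd x].

Definition edge n (c : code) : {set vtx n} :=
  [set v | (coord v == c.2) || (coord v == far_end c)].

Lemma coord_eq n (u v : vtx n) : (u == v) = (coord u == coord v).
Proof. by case: u v => [a b] [c d]; rewrite /Defs.coord !xpair_eqE -!val_eqE. Qed.

Lemma coord_bound n (v : vtx n) : ((coord v).1 <= 4 * n) && ((coord v).2 <= 3).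
Proof. by case: v => [[a la] [b lb]] /=; lia. Qed.

Lemma coord_surj n x y : x <= 4 * n -> y <= 3 -> exists v : vtx n, coord v = (x, y).
Proof.
move=> lx ly; have lx' : x < 4 * n + 1 by lia.
by exists (Ordinal lx', Ordinal (ly : y < 4)).
Qed.

Lemma adjP n (u v : vtx n) :
  reflect (exists2 c, is_code n c &
             (coord u, coord v) = (c.2, far_end c) \/ (coord u, coord v) = (far_end c, c.2))
          (adj u v).
Proof.
rewrite /adj; case: u v => [[x1 lx1] [y1 ly1]] [[x2 lx2] [y2 ly2]]; rewrite /coord /=.
apply: (iffP hasP) => [[[a b]]|[[d [x y]] cc H]].
- move=> hin; have hab :
    (a < 4 * n) && ((b == 1) && ~~ odd a || ((b == 0) || (b == 2)) && (a %% 4 == 1)).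
    by move: hin; rewrite !mem_cat => /or3P[] /mapP[k]; rewrite mem_iota => lk [-> ->]; lia.
  rewrite /hex_side => H.
  have : (y1 = y2 /\ x2 = x1.+1) \/ (y1 = y2 /\ x1 = x2.+1) \/
         (x1 = x2 /\ y2 = y1.+1) \/ (x1 = x2 /\ y1 = y2.+1) by lia.
  case=> [|[|[]]] [? ?]; subst.
  + by exists (true, (x1, y2)); [rewrite /is_code; lia | left].
  + by exists (true, (x2, y2)); [rewrite /is_code; lia | right].
  + by exists (false, (x2, y1)); [rewrite /is_code; lia | left].
  + by exists (false, (x2, y2)); [rewrite /is_code; lia | right].
have in0 k : k < 2 * n -> (2 * k, 1) \in pyrene_hexagons n.
  by move=> lk; rewrite mem_cat map_f // mem_iota.
have in1 k : k < n -> (4 * k + 1, 2) \in pyrene_hexagons n.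
  by move=> lk; rewrite !mem_cat [X in _ || (X || _)]map_f ?orbT // mem_iota.
have in2 k : k < n -> (4 * k + 1, 0) \in pyrene_hexagons n.
  by move=> lk; rewrite !mem_cat [X in _ || (_ || X)]map_f ?orbT // mem_iota.
have [h hin hs] : exists2 h, h \in pyrene_hexagons n &
    hex_side h (x, y) (far_end (d, (x, y))) && hex_side h (far_end (d, (x, y))) (x, y).
  rewrite /far_end /hex_side; case: d cc {H} => /= cc.
  - case: (boolP ((y == 1) || (y == 2))) => hy.
      by exists (2 * (x %/ 2), 1); [apply: in0; lia | lia].
    case: (boolP (y == 0)) => hy0.
      by exists (4 * (x %/ 4) + 1, 0); [apply: in2; lia | lia].
    by exists (4 * (x %/ 4) + 1, 2); [apply: in1; lia | lia].
  - case: (boolP (y == 1)) => hy.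
      case: (ltnP x (4 * n)) => hx.
        by exists (2 * (x %/ 2), 1); [apply: in0; lia | lia].
      by exists (2 * (x %/ 2).-1, 1); [apply: in0; lia | lia].
    case: (boolP (y == 0)) => hy0.
      by exists (4 * (x %/ 4) + 1, 0); [apply: in2; lia | lia].
    by exists (4 * (x %/ 4) + 1, 2); [apply: in1; lia | lia].
case/andP: hs => hs1 hs2; exists h => //.
case: H => H; have e1 : (x1, y1) = _ := congr1 fst H;
  have e2 : (x2, y2) = _ := congr1 snd H; by rewrite e1 e2.
Qed.

Lemma edgeP n (e : {set vtx n}) :
  reflect (exists2 c, is_code n c & e = edge n c) (e \in pyr_edges n).
Proof.
rewrite inE; apply: (iffP existsP) =>
  [[u /existsP[v /andP[/adjP[c cc H] /eqP->]]]|[[d [x y]] cc ->]].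
  exists c => //; apply/setP => z; rewrite !inE.
  by rewrite !coord_eq; case: H => -[-> ->] //; rewrite orbC.
set p := far_end (d, (x, y)).
have /andP[lx ly] : (x <= 4 * n) && (y <= 3) by move: cc; rewrite /is_code; case: (d); lia.
have /andP[lx' ly'] : (p.1 <= 4 * n) && (p.2 <= 3).
  by rewrite /p /far_end; move: cc; rewrite /is_code; case: (d) => /=; lia.
have [u cu] := coord_surj lx ly; have [v] := coord_surj lx' ly'.
rewrite -surjective_pairing => cv.
exists u; apply/existsP; exists v; apply/andP; split.
  by apply/adjP; exists (d, (x, y)) => //; left; rewrite cu cv.
apply/eqP/setP => z; by rewrite !inE !coord_eq cu cv.
Qed.


Lemma edge_inj n : {in is_code n &, injective (edge n)}.
Proof.
move=> [d [x y]] [d' [x' y']]; rewrite -!topredE /= => c1 c2 eqe.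
have /andP[lx ly] : (x <= 4 * n) && (y <= 3) by move: c1; case: (d); lia.
have /andP[lx' ly'] : (x' <= 4 * n) && (y' <= 3) by move: c2; case: (d'); lia.
have [v cv] := coord_surj lx ly; have [v' cv'] := coord_surj lx' ly'.
have [u cu] : exists u : vtx n, coord u = far_end (d, (x, y)).
  by move: c1; rewrite /far_end; case: (d) => /= ?; apply: coord_surj; lia.
have [u' cu'] : exists u : vtx n, coord u = far_end (d', (x', y')).
  by move: c2; rewrite /far_end; case: (d') => /= ?; apply: coord_surj; lia.
have := congr1 (fun A : {set vtx n} => v \in A) eqe.
have := congr1 (fun A : {set vtx n} => v' \in A) eqe.
have := congr1 (fun A : {set vtx n} => u \in A) eqe.
have := congr1 (fun A : {set vtx n} => u' \in A) eqe.
rewrite !inE cv cv' cu cu' !eqxx ?orbT /far_end /=.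
case: d {c1 eqe cu}; case: d' {c2 cu'} => /=; rewrite !xpair_eqE => h1 h2 h3 h4.
- by have [-> ->] : x = x' /\ y = y' by lia.
- by lia.
- by lia.
- by have [-> ->] : x = x' /\ y = y' by lia.
Qed.

Definition incident (p : nat * nat) : seq code :=
  let: (x, y) := p in
  [:: (true, (x, y)); (false, (x, y))]
  ++ (if x is x'.+1 then [:: (true, (x', y))] else [::])
  ++ (if y is y'.+1 then [:: (false, (x, y'))] else [::]).

Lemma incident_uniq p : uniq (incident p).
Proof.
case: p => [[|x] [|y]] //=; rewrite !inE /= ?xpair_eqE ?andbT /=; lia.
Qed.

Lemma mem_incident n (v : vtx n) c : (v \in edge n c) = (c \in incident (coord v)).
Proof.
case: c => [d [x y]]; rewrite inE /far_end; case: (coord v) => a b.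
by case: a b d => [|a] [|b] [] /=; rewrite !inE !xpair_eqE /=; lia.
Qed.

Lemma pyr_verticesE n (v : vtx n) :
  (v \in pyr_vertices n) = has (is_code n) (incident (coord v)).
Proof.
rewrite inE; apply/existsP/hasP => [[e /andP[/edgeP[c cc ->]]]|[c cin cc]].
  by rewrite mem_incident; exists c.
by exists (edge n c); rewrite mem_incident cin andbT; apply/edgeP; exists c.
Qed.

Lemma degreeE n (M : {set {set vtx n}}) (v : vtx n) : M \subset pyr_edges n ->
  #|[set e in M | v \in e]| = count (fun c => is_code n c && (edge n c \in M)) (incident (coord v)).
Proof.
move=> /subsetP sM; rewrite -size_filter; set s := filter _ _.
have us : uniq (map (edge n) s).
  rewrite map_inj_in_uniq ?filter_uniq ?incident_uniq //.
  by move=> c c'; rewrite !mem_filter => /andP[/andP[cc _] _] /andP[/andP[cc' _] _];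
    apply: edge_inj.
rewrite -(size_map (edge n)) -(card_uniqP us); apply: eq_card => e; rewrite !inE.
apply/andP/mapP => [[eM ve]|[c]].
  have /edgeP[c cc ee] := sM e eM; exists c => //.
  by rewrite mem_filter cc -ee eM -mem_incident -ee.
by rewrite mem_filter -mem_incident => /andP[/andP[_ h1] h2] ->.
Qed.

Definition edges_of n (P : pred code) : {set {set vtx n}} :=
  [set e in pyr_edges n | [exists v : vtx n, exists d,
     [&& is_code n (d, coord v), e == edge n (d, coord v) & P (d, coord v)]]].

Lemma edges_of_sub n P : edges_of n P \subset pyr_edges n.
Proof. by apply/subsetP => e; rewrite inE => /andP[]. Qed.

Lemma mem_edges_of n P c : is_code n c -> (edge n c \in edges_of n P) = P c.
Proof.
move=> cc; rewrite inE; apply/andP/idP => [[_ /existsP[v /existsP[d /and3P[c' /eqP e]]]]|Pc].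
  by rewrite (edge_inj _ _ e).
split; first by apply/edgeP; exists c.
case: c cc Pc => d [x y] cc Pc.
have /andP[lx ly] : (x <= 4 * n) && (y <= 3) by move: cc; rewrite /is_code; case: (d); lia.
have [v cv] := coord_surj lx ly.
by apply/existsP; exists v; apply/existsP; exists d; rewrite cv cc Pc eqxx.
Qed.

Lemma edges_of_ext n (M : {set {set vtx n}}) P : M \subset pyr_edges n ->
  (forall c, is_code n c -> (edge n c \in M) = P c) -> M = edges_of n P.
Proof.
move=> /subsetP sM H; apply/setP => e; apply/idP/idP => eM.
  by have /edgeP[c cc ee] := sM e eM; rewrite ee mem_edges_of // -H // -ee.
have /edgeP[c cc ee] := subsetP (edges_of_sub n P) e eM.
by move: eM; rewrite ee mem_edges_of // H.
Qed.

Lemma perfect_matchingP n (M : {set {set vtx n}}) :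
  reflect (M \subset pyr_edges n /\ forall x y, x <= 4 * n -> y <= 3 ->
     has (is_code n) (incident (x, y)) ->
     count (fun c => is_code n c && (edge n c \in M)) (incident (x, y)) = 1)
   (perfect_matching M).
Proof.
apply: (iffP andP) => -[sM H]; split=> //.
  move=> x y lx ly hc; have [v cv] := coord_surj lx ly.
  have vv : v \in pyr_vertices n by rewrite pyr_verticesE cv.
  by have /implyP/(_ vv)/eqP := forallP H v; rewrite degreeE // cv.
apply/forallP => v; apply/implyP; rewrite pyr_verticesE degreeE //.
by case: (coord v) (coord_bound v) => x y /= /andP[lx ly] hc; apply/eqP; apply: H.
Qed.

Arguments is_code : simpl never.

Lemma is_codeH n i r y : r < 4 ->
  is_code n (true, (4 * i + r, y)) =
  (i < n) && [|| y == 1, y == 2 | ((y == 0) || (y == 3)) && ((r == 1) || (r == 2))].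
Proof. by move=> lr; rewrite /is_code; lia. Qed.

Lemma is_codeV n i r y : r < 4 ->
  is_code n (false, (4 * i + r, y)) =
  [&& 0 < n, i + (r != 0) <= n & (y == 1) && ~~ odd r || ((y == 0) || (y == 2)) && odd r].
Proof. by move=> lr; rewrite /is_code; lia. Qed.

Lemma count_incidentS (P : pred code) i r y :
  count P (incident (4 * i + r.+1, y)) =
  P (true, (4 * i + r.+1, y)) + P (false, (4 * i + r.+1, y)) + P (true, (4 * i + r, y))
  + (if y is y'.+1 then P (false, (4 * i + r.+1, y')) else false).
Proof. by rewrite addnS /incident; case: y => [|y] /=; rewrite ?addn0 !addnA. Qed.

Lemma count_incident0 (P : pred code) i y :
  count P (incident (4 * i + 0, y)) =
  P (true, (4 * i + 0, y)) + P (false, (4 * i + 0, y))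
  + (if i is j.+1 then P (true, (4 * j + 3, y)) else false)
  + (if y is y'.+1 then P (false, (4 * i + 0, y')) else false).
Proof.
case: i => [|i]; first by case: y => [|y] /=; rewrite ?addn0 ?addnA.
have -> : 4 * i.+1 + 0 = (4 * i + 3).+1 by lia.
by case: y => [|y] /=; rewrite ?addn0 !addnA.
Qed.

(** * Words and their matchings *)

(* [inl false] and [inl true] are the letters A and C; [inr (t, b)] is a letter B, where [t] (for
   the row [y = 2]) and [b] (for [y = 1]) tell whether [4i+1] is the odd column matched inside
   the row. *)
Definition letter := (bool + bool * bool)%type.

Definition lB : letter := inr (true, true).

Definition is_mid (a : letter) : bool := if a is inr _ then true else false.

Definition keeps_left (top : bool) (a : letter) : bool :=
  match a with inl c => ~~ c | inr (t, b) => if top then t else b end.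

(* [hpat a r y] and [vpat prev a r y]: is the horizontal, resp. vertical, edge at [(4i + r, y)]
   matched, when fragment [i] has letter [a] and fragment [i - 1] letter [prev]? *)
Definition hpat (a : letter) (r y : nat) : bool :=
  let l := keeps_left (1 < y) a in
  if (y == 1) || (y == 2) then
    nth false [:: a == inl false; is_mid a && l; is_mid a && ~~ l; a == inl true] r
  else nth false [:: false; l; ~~ l; false] r.

Definition vpat (prev a : letter) (r y : nat) : bool :=
  let l := keeps_left (1 < y) a in
  if y == 1 then
    nth false [:: (prev != inl true) && (a != inl false); false; ~~ is_mid a; false] r
  else nth false [:: false; ~~ l; false; l] r.

(* The default letter [lB] outside the word is harmless: B letters are compatible with all
   letters and leave the rungs at columns [0] and [4n] unconstrained. *)
Definition pattern (w : seq letter) (c : code) : bool :=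
  let: (d, (x, y)) := c in
  let a := nth lB w (x %/ 4) in
  if d then hpat a (x %% 4) y else vpat (nth lB (lB :: w) (x %/ 4)) a (x %% 4) y.

Arguments pattern : simpl never.

Definition word_matching n (w : seq letter) : {set {set vtx n}} := edges_of n (pattern w).

Definition compatible (a b : letter) : bool := ~~ ((a == inl true) && (b == inl false)).

Lemma patternH w i r y : r < 4 -> pattern w (true, (4 * i + r, y)) = hpat (nth lB w i) r y.
Proof.
move=> lr; rewrite /pattern.
have -> : (4 * i + r) %/ 4 = i by lia.
by have -> : (4 * i + r) %% 4 = r by lia.
Qed.

Lemma patternV w i r y : r < 4 ->
  pattern w (false, (4 * i + r, y)) = vpat (nth lB (lB :: w) i) (nth lB w i) r y.
Proof.
move=> lr; rewrite /pattern.
have -> : (4 * i + r) %/ 4 = i by lia.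
by have -> : (4 * i + r) %% 4 = r by lia.
Qed.

Lemma word_matching_perfect n w : size w = n -> sorted compatible w ->
  perfect_matching (word_matching n w).
Proof.
move=> sw ok; apply/perfect_matchingP; split; first exact: edges_of_sub.
move=> x y lx ly hc.
rewrite (@eq_count _ _ (fun c => is_code n c && pattern w c)); last first.
  by move=> c /=; case: (boolP (is_code n c)) => //= cc; rewrite mem_edges_of.
move: hc; rewrite has_count.
have [i [r [lr ex]]] : exists i r, r < 4 /\ x = 4 * i + r.
  by exists (x %/ 4), (x %% 4); lia.
have cmp : forall j, j.+1 < n -> compatible (nth lB w j) (nth lB w j.+1).
  by rewrite -sw; apply/sortedP.
subst x; case: r lr lx => [|r] lr lx.
  rewrite !count_incident0.
  case: i lx => [|i] lx.
    case: y ly => [|[|[|[|]]]] //= _;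
      rewrite !is_codeH // !is_codeV // !patternH // !patternV //=;
      by case: n {sw cmp lx} => [|n] //=; case: (nth lB w 0) => [[]|[]] //= [] [].
  have lin : i < n by lia.
  have n0 : 0 < n by lia.
  have := cmp i; have [lin1|gein] := ltnP i.+1 n.
    move=> /(_ isT).
    case: y ly => [|[|[|[|]]]] //= _;
      rewrite !is_codeH // !is_codeV // !patternH // !patternV //= lin n0 ?addn0 lin lin1 /=;
      by case: (nth lB w i) => [[]|[]] //=; case: (nth lB w i.+1) => [[]|[]].
  move=> _; have ngt : (i.+1 < n) = false by lia.
  have nB : nth lB w i.+1 = lB by rewrite nth_default // sw.
  case: y ly => [|[|[|[|]]]] //= _;
      rewrite !is_codeH // !is_codeV // !patternH // !patternV //= lin n0 ?addn0 lin nB ngt /=;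
    by case: (nth lB w i) => [[]|[]].
have lin : i < n by lia.
have n0 : 0 < n by lia.
have lin1 : i + 1 <= n by lia.
rewrite !count_incidentS.
by case: r lr lx => [|[|[|r]]] // lr lx; case: y ly => [|[|[|[|]]]] //= _;
  rewrite !is_codeH // !is_codeV // !patternH // !patternV //= lin n0 /= lin1 /=;
  case: (nth lB w i) => [[]|[[] []]].
Qed.

(** * The word of a perfect matching *)

Definition letter_of (chi : pred code) (i : nat) : letter :=
  if chi (true, (4 * i + 0, 2)) then inl false
  else if chi (true, (4 * i + 3, 2)) then inl true
  else inr (chi (true, (4 * i + 1, 3)), chi (true, (4 * i + 1, 0))).

Section Decode.
Variables (n : nat) (chi : pred code).
Hypothesis chi_code : forall c, chi c -> is_code n c.
Hypothesis chi_deg : forall x y, x <= 4 * n -> y <= 3 ->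
  has (is_code n) (incident (x, y)) -> count chi (incident (x, y)) = 1.

Let H i r y := chi (true, (4 * i + r, y)).
Let V i r y := chi (false, (4 * i + r, y)).

Lemma chi_codeN c : ~~ is_code n c -> chi c = false.
Proof. by apply: contraNF; apply: chi_code. Qed.

Lemma degree_interior i r y : i < n -> r < 3 -> y <= 3 ->
  H i r.+1 y + V i r.+1 y + H i r y + (if y is y'.+1 then V i r.+1 y' else false) = 1.
Proof.
move=> lin lr ly; rewrite -count_incidentS chi_deg //; first lia.
rewrite has_count count_incidentS; case: y r lr ly => [|[|[|[|]]]] // [|[|[|]]] //= _ _;
  rewrite !is_codeH // !is_codeV //; lia.
Qed.

Lemma degree_shared i y : 0 < n -> i <= n -> (y == 1) || (y == 2) ->
  (if i is j.+1 then H j 3 y else false) + H i 0 y + V i 0 1 = 1.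
Proof.
move=> n0 lin hy.
have lx : 4 * i + 0 <= 4 * n by lia.
have ly : y <= 3 by lia.
have hc : has (is_code n) (incident (4 * i + 0, y)).
  by rewrite has_count count_incident0; case/orP: hy => /eqP-> /=; rewrite !is_codeV //; lia.
have := chi_deg lx ly hc; rewrite count_incident0 -/(H i 0 y).
case/orP: hy => /eqP-> /=; rewrite -/(V i 0 _).
  rewrite (@chi_codeN (false, (_, 0))) ?is_codeV //; last by rewrite /= !andbF.
  by case: i {lin lx ly hc} => [|i]; rewrite -?/(H i 3 1); lia.
have -> : V i 0 2 = false by apply: chi_codeN; rewrite is_codeV //= !andbF.
rewrite -/(V i 0 1).
by case: i {lin lx ly hc} => [|i]; rewrite -?/(H i 3 2); lia.
Qed.

Lemma half_fragment i (top : bool) : i < n ->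
  let: (yo, yi, yv) := if top then (3, 2, 2) else (0, 1, 0) in
  let l := H i 1 yo in
  [/\ H i 2 yo = ~~ l, V i 1 yv = ~~ l, V i 3 yv = l, H i 0 yi ==> l & H i 3 yi ==> ~~ l] /\
  [/\ H i 1 yi = ~~ H i 0 yi && l, H i 2 yi = ~~ H i 3 yi && ~~ l
    & V i 2 1 = H i 0 yi || H i 3 yi].
Proof.
move=> lin; case: top => /=.
- have := @degree_interior i 0 3 lin isT isT; have := @degree_interior i 1 3 lin isT isT.
  have := @degree_interior i 2 3 lin isT isT; have := @degree_interior i 0 2 lin isT isT.
  have := @degree_interior i 1 2 lin isT isT; have := @degree_interior i 2 2 lin isT isT.
  rewrite /=.
  have -> : H i 0 3 = false by apply: chi_codeN; rewrite is_codeH //= andbF.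
  have -> : H i 3 3 = false by apply: chi_codeN; rewrite is_codeH //= andbF.
  have -> : V i 1 3 = false by apply: chi_codeN; rewrite is_codeV //= !andbF.
  have -> : V i 2 3 = false by apply: chi_codeN; rewrite is_codeV //= !andbF.
  have -> : V i 3 3 = false by apply: chi_codeN; rewrite is_codeV //= !andbF.
  have -> : V i 2 2 = false by apply: chi_codeN; rewrite is_codeV //= !andbF.
  have -> : V i 1 1 = false by apply: chi_codeN; rewrite is_codeV //= !andbF.
  have -> : V i 3 1 = false by apply: chi_codeN; rewrite is_codeV //= !andbF.
  case: (H i 1 3) => /=; case: (H i 2 3) => //=; case: (V i 1 2) => //=; case: (V i 3 2) => //=;
  case: (H i 0 2) => //=; case: (H i 1 2) => //=; case: (H i 2 2) => //=; case: (H i 3 2) => //=;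
  by case: (V i 2 1).
- have := @degree_interior i 0 0 lin isT isT; have := @degree_interior i 1 0 lin isT isT.
  have := @degree_interior i 2 0 lin isT isT; have := @degree_interior i 0 1 lin isT isT.
  have := @degree_interior i 1 1 lin isT isT; have := @degree_interior i 2 1 lin isT isT.
  rewrite /=.
  have -> : H i 0 0 = false by apply: chi_codeN; rewrite is_codeH //= andbF.
  have -> : H i 3 0 = false by apply: chi_codeN; rewrite is_codeH //= andbF.
  have -> : V i 2 0 = false by apply: chi_codeN; rewrite is_codeV //= !andbF.
  have -> : V i 1 1 = false by apply: chi_codeN; rewrite is_codeV //= !andbF.
  have -> : V i 3 1 = false by apply: chi_codeN; rewrite is_codeV //= !andbF.
  case: (H i 1 0) => /=; case: (H i 2 0) => //=; case: (V i 1 0) => //=; case: (V i 3 0) => //=;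
  case: (H i 0 1) => //=; case: (H i 1 1) => //=; case: (H i 2 1) => //=; case: (H i 3 1) => //=;
  by case: (V i 2 1).
Qed.

(* Column [4i] receives at most one horizontal edge in each row and its rung is common to both
   rows, so agreement propagates from fragment [i - 1] to fragment [i]. *)
Lemma halves_agree i : i < n -> H i 0 2 = H i 0 1 /\ H i 3 2 = H i 3 1.
Proof.
elim: i => [|i IH] lin.
  have := degree_shared (y := 1) lin (ltnW lin) isT.
  have := degree_shared (y := 2) lin (ltnW lin) isT.
  have := half_fragment true lin; have := half_fragment false lin => /=.
  case=> -[_ _ _ h1 h2] [_ _ ->] [[_ _ _ h3 h4] [_ _]].
  move: h1 h2 h3 h4;
  case: (H 0 0 1); case: (H 0 3 1); case: (H 0 0 2); case: (H 0 3 2); case: (V 0 0 1) => //=;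
  case: (H 0 1 0) => //=; case: (H 0 1 3) => //=.
have n0 : 0 < n by lia.
have := degree_shared (y := 1) n0 (ltnW lin) isT.
have := degree_shared (y := 2) n0 (ltnW lin) isT => /=.
have [_ ->] := IH (ltnW lin).
have := half_fragment true lin; have := half_fragment false lin => /=.
case=> -[_ _ _ h1 h2] [_ _ ->] [[_ _ _ h3 h4] [_ _]].
move: h1 h2 h3 h4; set j := i.+1; case: (H i 3 1);
 case: (H j 0 1); case: (H j 3 1); case: (H j 0 2); case: (H j 3 2); case: (V j 0 1) => //=;
case: (H j 1 0) => //=; case: (H j 1 3) => //=.
Qed.

Definition word_of := mkseq (letter_of chi) n.

Lemma word_of_pattern c : is_code n c -> chi c = pattern word_of c.
Proof.
case: c => d [x y].
have [i [r [lr ->]]] : exists i r, r < 4 /\ x = 4 * i + r.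
  by exists (x %/ 4), (x %% 4); lia.
case: d; rewrite ?is_codeH ?is_codeV ?patternH ?patternV //.
- case/andP=> lin hy; rewrite nth_mkseq // /letter_of -!/(H i _ _).
  have := half_fragment true lin; have := half_fragment false lin => /=.
  have [e1 e2] := halves_agree lin.
  case=> -[a1 a2 a3 a4 a5] [a6 a7 a8] [[b1 b2 b3 b4 b5] [b6 b7 b8]].
  rewrite -/(H i r y); move: a4 a5 b4 b5; rewrite -e1 -e2.
  case: r lr hy => [|[|[|[|]]]] // _; case: y => [|[|[|[|]]]] //= _;
   rewrite ?a1 ?a6 ?a7 ?b1 ?b6 ?b7 -?e1 -?e2;
   case: (H i 0 2); case: (H i 3 2); case: (H i 1 0); case: (H i 1 3) => //=.
- case/and3P=> n0; case: r lr => [|r] lr.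
    rewrite /= [i + _]addn0 => lin /orP[]; last by rewrite andbF.
    rewrite andbT => /eqP ->; rewrite -/(V i 0 1).
    have := degree_shared (y := 2) n0 lin isT.
    have -> : nth lB (lB :: word_of) i = if i is j.+1 then letter_of chi j else lB.
      by case: (i) lin => [|j] lj //; rewrite [LHS]/= nth_mkseq.
    have [lt|ge] := ltnP i n.
      rewrite nth_mkseq // /vpat /= /letter_of; case: i lin lt => [|i] lin lt; rewrite -!/(H _ _ _).
        have := half_fragment true lt => /= -[[_ _ _ h1 h2] _].
        by move: h1 h2; case: (H 0 0 2); case: (H 0 3 2); case: (H 0 1 3); case: (V 0 0 1) => //=.
      have := half_fragment true lin => /= -[[_ _ _ h1 h2] _].
      by move: h1 h2; case: (H i 0 2); case: (H i 3 2); case: (H i 1 3);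
        case: (H i.+1 0 2); case: (H i.+1 3 2); case: (V i.+1 0 1) => //=.
    rewrite nth_default ?size_mkseq // /vpat /= /letter_of.
    have -> : H i 0 2 = false by apply: chi_codeN; rewrite is_codeH //; lia.
    case: i lin ge => [|i] lin ge; first by lia.
    rewrite -!/(H _ _ _); have := half_fragment true lin => /= -[[_ _ _ h1 h2] _].
    by move: h1 h2; case: (H i 0 2); case: (H i 3 2); case: (H i 1 3); case: (V i.+1 0 1) => //=.
  rewrite addn1 => lin hy.
  rewrite nth_mkseq // /letter_of -!/(H i _ _).
  have := half_fragment true lin; have := half_fragment false lin => /=.
  have [e1 e2] := halves_agree lin.
  case=> -[a1 a2 a3 a4 a5] [a6 a7 a8] [[b1 b2 b3 b4 b5] [b6 b7 b8]].
  rewrite -/(V i r.+1 y); move: a4 a5 b4 b5; rewrite -e1 -e2.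
  case: r lr hy => [|[|[|]]] // _; case: y => [|[|[|[|]]]] //= _;
   rewrite ?a2 ?a3 ?b2 ?b3 ?b8 /vpat /=;
   case: (H i 0 2); case: (H i 3 2); case: (H i 1 0); case: (H i 1 3) => //=.
Qed.

Lemma word_of_compatible : sorted compatible word_of.
Proof.
apply/(sortedP lB) => i; rewrite size_mkseq => lin; rewrite !nth_mkseq //; last exact: ltnW.
have n0 : 0 < n by lia.
have := degree_shared (y := 2) n0 (ltnW lin) isT => /=.
rewrite /compatible /letter_of -!/(H _ _ _).
by case: (H i.+1 0 2); case: (H i 3 2) => //=; case: (H i 0 2); case: (H i.+1 3 2).
Qed.
End Decode.

Lemma perfect_matching_word n (M : {set {set vtx n}}) : perfect_matching M ->
  exists w, [/\ size w = n, sorted compatible w & M = word_matching n w].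
Proof.
case/perfect_matchingP => sM deg.
set chi := fun c => is_code n c && (edge n c \in M) in deg.
have cc c : chi c -> is_code n c by case/andP.
exists (word_of n chi); split; first exact: size_mkseq.
  exact: word_of_compatible.
by apply: edges_of_ext => // c cd; rewrite -(word_of_pattern cc) // /chi cd.
Qed.

(** * Forcing numbers *)

Definition cert (a : letter) (i : nat) : seq code :=
  match a with
  | inl false => [:: (true, (4 * i + 0, 2))]
  | inl true => [:: (true, (4 * i + 3, 2))]
  | inr (t, b) => [:: (true, (4 * i + (if t then 1 else 2), 2));
                      (true, (4 * i + (if b then 1 else 2), 1))]
  end.

Lemma cert_code n a i : i < n -> all (is_code n) (cert a i).
Proof.
by move=> lin; case: a => [[]|[[] []]] /=; rewrite !is_codeH //= lin.
Qed.

Lemma certP w a i : all (pattern w) (cert a i) = (nth lB w i == a).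
Proof.
case: a => [[]|[[] []]] /=; rewrite !patternH //=; case: (nth lB w i) => [[]|[[] []]] //.
Qed.

Lemma cert_inj n w w' : size w = n -> size w' = n ->
  (forall i c, i < n -> c \in cert (nth lB w i) i -> edge n c \in word_matching n w') -> w = w'.
Proof.
move=> sw sw' H; apply: (@eq_from_nth _ lB); first by rewrite sw sw'.
rewrite sw => i lin; apply/esym/eqP; rewrite -certP; apply/allP => c cin.
by have := H i c lin cin; rewrite mem_edges_of // (allP (cert_code _ lin) _ cin).
Qed.

Lemma mem_cert n w i c : i < n -> c \in cert (nth lB w i) i -> edge n c \in word_matching n w.
Proof.
move=> lin cin; rewrite mem_edges_of ?(allP (cert_code _ lin) _ cin) //.
by have := certP w (nth lB w i) i; rewrite eqxx => /allP; apply.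
Qed.

Lemma word_matching_inj n w w' : size w = n -> size w' = n ->
  word_matching n w = word_matching n w' -> w = w'.
Proof. by move=> sw sw' e; apply: (cert_inj sw sw') => i c; rewrite -e; apply: mem_cert. Qed.

Definition cost (w : seq letter) : nat := \sum_(a <- w) (is_mid a).+1.

Definition certificate n w : {set {set vtx n}} :=
  [set e in flatten [seq map (edge n) (cert (nth lB w i) i) | i <- iota 0 n]].

Lemma certificate_card n w : size w = n -> #|certificate n w| <= cost w.
Proof.
move=> sw; rewrite cardsE (leq_trans (card_size _)) // size_flatten /shape -map_comp sumnE big_map.
rewrite /cost (big_nth lB) sw /index_iota subn0; apply: leq_sum => i _ /=; rewrite size_map.
by case: (nth lB w i) => [[]|[]].
Qed.

Lemma mem_certificate n w i c : i < n -> c \in cert (nth lB w i) i -> edge n c \in certificate n w.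
Proof.
move=> lin cin; rewrite inE; apply/flatten_mapP; exists i; first by rewrite mem_iota.
exact: map_f.
Qed.

Lemma certificate_forcing n w : size w = n -> forcing_set (word_matching n w) (certificate n w).
Proof.
move=> sw; apply/andP; split.
  apply/subsetP => e; rewrite inE => /flatten_mapP[i].
  rewrite mem_iota add0n => /= lin /mapP[c cin ->].
  exact: (mem_cert lin cin).
apply/forallP => M'; apply/implyP => /andP[/perfect_matching_word[w' [sw' _ ->]] /subsetP sub].
apply/eqP; congr word_matching; apply/esym/(cert_inj sw sw') => i c lin cin.
exact: sub _ (mem_certificate lin cin).
Qed.

Definition flip (a : letter) (top : bool) : letter :=
  match a with
  | inl _ => lB
  | inr (t, b) => if top then inr (~~ t, b) else inr (t, ~~ b)
  end.

Lemma flip_mid a top : is_mid (flip a top).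
Proof. by case: a => [[]|[[] []]]; case: top. Qed.

Lemma mid_compatible a b : is_mid a -> compatible a b * compatible b a.
Proof. by case: a => [[]|[? ?]] //= _; case: b => [[]|[? ?]]. Qed.

Lemma flip_compatible w i top : i < size w -> sorted compatible w ->
  sorted compatible (set_nth lB w i (flip (nth lB w i) top)).
Proof.
move=> lin /(sortedP lB) ok; have sz : size (set_nth lB w i (flip (nth lB w i) top)) = size w.
  by rewrite size_set_nth; lia.
apply/(sortedP lB) => j; rewrite sz => lj; rewrite !nth_set_nth /=.
case: eqP => _; first by rewrite (mid_compatible _ (flip_mid _ _)).
by case: eqP => _; [rewrite (mid_compatible _ (flip_mid _ _)) | apply: ok].
Qed.

(* Names the demand that an edge of a forcing set can meet: a fragment with letter A or C has the
   single demand [(i, true)], one with letter B has one demand for each row. *)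
Definition tag (w : seq letter) (c : code) : nat * bool :=
  let i := c.2.1 %/ 4 in (i, is_mid (nth lB w i) ==> (1 < c.2.2)).

Lemma flip_tag n w i top c : i < size w -> top || is_mid (nth lB w i) -> is_code n c ->
  pattern w c -> ~~ pattern (set_nth lB w i (flip (nth lB w i) top)) c -> tag w c = (i, top).
Proof.
move=> lin hd; case: c => d [x y].
have [j [r [lr ->]]] : exists i r, r < 4 /\ x = 4 * i + r.
  by exists (x %/ 4), (x %% 4); lia.
rewrite /tag /=; have -> : (4 * j + r) %/ 4 = j by lia.
case: d; rewrite ?is_codeH ?is_codeV ?patternH ?patternV // => hc.
  rewrite nth_set_nth /=; case: eqP => [->|_]; last by move=> ->.
  case/andP: hc => _; case: r lr => [|[|[|[|]]]] // _; case: y => [|[|[|[|]]]] //= _;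
  by move: hd; case: (nth lB w i) => [[]|[[] []]] //=; case: top.
have -> : nth lB (lB :: set_nth lB w i (flip (nth lB w i) top)) j =
  if j == i.+1 then flip (nth lB w i) top else nth lB (lB :: w) j.
  by case: j {hc} => [|j] //; rewrite eqSS /= nth_set_nth.
rewrite nth_set_nth /=; have ijN : (i == i.+1) = false by lia.
case: (j =P i) => [->|_]; rewrite ?ijN.
  case/and3P: hc => _ _; case: r lr => [|[|[|[|]]]] // _; case: y => [|[|[|[|]]]] //= _;
  by move: hd; rewrite /vpat; case: (nth lB w i) => [[]|[[] []]] //=;
     case: top => //=; case: (nth _ _ _ == _).
case: eqP => [->|_]; last by move=> ->.
case/and3P: hc => _ _; case: r lr => [|[|[|[|]]]] // _; case: y => [|[|[|[|]]]] //= _;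
  rewrite /vpat /=; move: hd; case: (nth lB w i) => [[]|[[] []]] //=; case: top => //= _;
  try (by move=> ->); case: (nth _ _ _) => [[]|[[] []]] //=.
Qed.

Lemma flip_neq a top : flip a top != a.
Proof. by case: a => [[]|[[] []]]; case: top. Qed.

Lemma forcing_card n w S : size w = n -> sorted compatible w ->
  forcing_set (word_matching n w) S -> cost w <= #|S|.
Proof.
move=> sw ok /andP[/subsetP sSM /forallP force].
pose D := [set d : 'I_n * bool | d.2 || is_mid (nth lB w d.1)].
have ex (d : 'I_n * bool) : exists c, d \in D ->
   [/\ is_code n c, edge n c \in S & tag w c = (val d.1, d.2)].
  case: (boolP (d \in D)) => [|_]; last by exists (true, (0, 0)).
  case: d => i top; rewrite inE /= => hd.
  have lin : i < size w by rewrite sw.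
  set w' := set_nth lB w i (flip (nth lB w i) top).
  have sw' : size w' = n by rewrite size_set_nth sw; have := ltn_ord i; lia.
  have := force (word_matching n w').
  rewrite word_matching_perfect ?flip_compatible //=.
  have -> : (word_matching n w' == word_matching n w) = false.
    apply/eqP => /(word_matching_inj sw' sw) e.
    have : nth lB w' i = flip (nth lB w i) top by rewrite nth_set_nth /= eqxx.
    by rewrite e => /esym/eqP; rewrite (negPf (flip_neq _ _)).
  rewrite implybF => /subsetPn[e eS eM].
  have eW := sSM e eS; have /edgeP[c cc ee] := subsetP (edges_of_sub _ _) e eW.
  rewrite ee mem_edges_of // in eM; rewrite ee mem_edges_of // in eW.
  by exists c; rewrite cc -ee eS; split=> //; apply: flip_tag lin hd cc eW eM.
have [f fP] := fin_all_exists ex.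
have cD : cost w = #|D|.
  rewrite /cost (big_nth lB) sw big_mkord -sum1dep_card.
  rewrite -(pair_big_dep xpredT (fun (i : 'I_n) b => b || is_mid (nth lB w i)) (fun _ _ => 1)) /=.
  by apply: eq_bigr => i _; rewrite big_mkcond big_bool /=; case: is_mid.
rewrite cD -(@card_in_imset _ _ (fun d => edge n (f d)) D).
  by apply/subset_leq_card/subsetP => e /imsetP[d dD ->]; have [] := fP d dD.
move=> d d' dD d'D; have [c1 _ t1] := fP d dD; have [c2 _ t2] := fP d' d'D.
move=> /(edge_inj c1 c2) e; move: t1; rewrite e t2 => -[/val_inj e1 e2].
by rewrite [d]surjective_pairing [d']surjective_pairing e1 e2.
Qed.

Lemma bigmin_le (I : eqType) (r : seq I) (P : pred I) (F : I -> nat) x i :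
  i \in r -> P i -> \big[minn/x]_(j <- r | P j) F j <= F i.
Proof.
elim: r => [|j r IH] //; rewrite inE big_cons => /orP[/eqP <- -> | ir Pi].
  exact: geq_minl.
by case: ifP => _; [apply: leq_trans (geq_minr _ _) _|]; apply: IH.
Qed.

Lemma forcing_number_word n w : size w = n -> sorted compatible w ->
  forcing_number (word_matching n w) = cost w.
Proof.
move=> sw ok; have fc := certificate_forcing sw; apply/eqP; rewrite eqn_leq; apply/andP; split.
  apply: leq_trans (certificate_card sw); apply: bigmin_le; rewrite ?mem_index_enum //.
  by rewrite fc powersetE; case/andP: fc => ->.
rewrite /forcing_number; elim/big_ind: _ => [|a b ha hb|S /andP[_]].
- by apply: leq_trans (forcing_card sw ok fc) (subset_leq_card _); case/andP: fc.
- by rewrite leq_min ha.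
- exact: forcing_card.
Qed.

(** * Counting words *)

Definition letters : seq letter :=
  [:: inl false; inl true; inr (false, false); inr (false, true);
      inr (true, false); inr (true, true)].

Fixpoint words n : seq (seq letter) :=
  if n is m.+1 then [seq a :: s | a <- letters, s <- words m] else [:: [::]].

Lemma wordsS n : words n.+1 = [seq a :: s | a <- letters, s <- words n].
Proof. by []. Qed.

Lemma mem_words n w : (w \in words n) = (size w == n).
Proof.
elim: n w => [|n IH] w; first by case: w.
rewrite wordsS; apply/allpairsP/eqP => [[[a s] /= [_ sw ->]]|].
  by move: sw; rewrite IH /= => /eqP->.
case: w => [|a s] // [es]; exists (a, s); split=> //=; last by rewrite IH es.
by case: a => [[]|[[] []]].
Qed.

Lemma words_uniq n : uniq (words n).
Proof.
elim: n => // n IH; rewrite wordsS; apply: allpairs_uniq => //.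
by move=> [a s] [b t] _ _ /= [-> ->].
Qed.

Definition word_sum n (F : seq letter -> nat) : nat :=
  \sum_(w <- words n | sorted compatible w) F w.

Lemma IDF_word_sum n : IDF n = word_sum n cost.
Proof.
rewrite /IDF /word_sum -big_filter; set W := filter _ _.
have Wok w : w \in W -> size w = n /\ sorted compatible w.
  by rewrite mem_filter mem_words => /andP[? /eqP].
have uM : uniq [seq word_matching n w | w <- W].
  rewrite map_inj_in_uniq ?filter_uniq ?words_uniq // => w w' /Wok[sw _] /Wok[sw' _].
  exact: word_matching_inj.
rewrite (eq_bigl (mem [seq word_matching n w | w <- W])).
  rewrite -big_uniq // big_map; apply: eq_big_seq => w /Wok[sw ok].
  exact: forcing_number_word.
move=> M; apply/idP/mapP => [/perfect_matching_word[w [sw ok ->]]|[w /Wok[sw ok] ->]].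
  by exists w => //; rewrite mem_filter ok mem_words sw /=.
exact: word_matching_perfect.
Qed.

Lemma word_sumS n F : word_sum n.+1 F =
  \sum_(a <- letters) \sum_(s <- words n | path compatible a s) F (a :: s).
Proof.
rewrite /word_sum big_mkcond wordsS big_allpairs_dep; apply: eq_bigr => a _.
by rewrite [RHS]big_mkcond.
Qed.

Lemma path_compatible a s : a != inl true -> path compatible a s = sorted compatible s.
Proof. by case: s => [|b s] //=; rewrite /compatible => /negPf ->. Qed.

(* Prepending a letter to a word can only create the forbidden factor at its front. *)
Lemma word_sum_rec n F :
  word_sum n.+2 F + word_sum n (fun s => F [:: inl true, inl false & s]) =
  \sum_(a <- letters) word_sum n.+1 (fun s => F (a :: s)).
Proof.
have eqc (a : letter) m : a != inl true ->
  \sum_(s <- words m | path compatible a s) F (a :: s) = word_sum m (fun s => F (a :: s)).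
  by move=> aC; apply: eq_bigl => s; rewrite path_compatible.
rewrite word_sumS /letters !big_cons !big_nil (eqc (inl false)) // !(eqc (inr _)) //.
suff -> : word_sum n.+1 (fun s => F (inl true :: s)) =
   \sum_(s <- words n.+1 | path compatible (inl true) s) F (inl true :: s)
   + word_sum n (fun s => F [:: inl true, inl false & s]).
  by rewrite -!addnA; congr (_ + (_ + _)); rewrite [RHS]addnC -!addnA.
rewrite word_sumS [X in _ = X + _]big_mkcond wordsS big_allpairs_dep /letters !big_cons !big_nil /=.
rewrite -!big_mkcond /= big1_eq add0n [RHS]addnC.
by congr (_ + _); apply: eq_bigl => s; rewrite path_compatible.
Qed.

Lemma cost_cons a s : cost (a :: s) = (is_mid a).+1 + cost s.
Proof. by rewrite /cost big_cons. Qed.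

Lemma word_sum_shift n k F :
  word_sum n (fun s => k + F s) = k * word_sum n (fun=> 1) + word_sum n F.
Proof.
rewrite /word_sum big_split big_distrr /=; congr (_ + _).
by apply: eq_bigr => *; rewrite muln1.
Qed.

Lemma word_count_rec n :
  word_sum n.+2 (fun=> 1) + word_sum n (fun=> 1) = 6 * word_sum n.+1 (fun=> 1).
Proof. by rewrite word_sum_rec /letters !big_cons big_nil; lia. Qed.

Lemma word_cost_rec n :
  word_sum n.+2 cost + word_sum n cost + 2 * word_sum n (fun=> 1) =
  6 * word_sum n.+1 cost + 10 * word_sum n.+1 (fun=> 1).
Proof.
have eqF m (F G : seq letter -> nat) : F =1 G -> word_sum m F = word_sum m G.
  by move=> e; apply: eq_bigr.
have := word_sum_rec n cost; rewrite /letters !big_cons big_nil.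
rewrite (eqF n _ (fun s => 2 + cost s)); last by move=> s; rewrite !cost_cons.
do 6 ?rewrite (eqF n.+1 (fun s => cost (_ :: s)) _ (cost_cons _)).
by rewrite !word_sum_shift /=; lia.
Qed.

Import Order.TTheory GRing.Theory Num.Theory.
Local Open Scope ring_scope.

Lemma word_count_closed (R : rcfType) n :
  (word_sum n (fun=> 1%N))%:R = Num.sqrt (2 : R) / 8 *
     ((3 + 2 * Num.sqrt 2) ^+ n.+1 - (3 - 2 * Num.sqrt 2) ^+ n.+1).
Proof.
set s := Num.sqrt 2; have s2 : s ^+ 2 = 2 by rewrite sqr_sqrtr // ler0n.
elim/ltn_ind: n => -[|[|n]] IH.
- by rewrite /word_sum unlock /= !expr1; field: s2.
- by rewrite /word_sum unlock /= ; field: s2.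
- have := congr1 (fun k => k%:R : R) (word_count_rec n).
  rewrite natrD natrM (IH n) ?(IH n.+1) // => /(canRL (addrK _)) ->.
  by rewrite !exprS; field: s2.
Qed.

Theorem theorem3p4 (R : rcfType) (n : nat) :
  (IDF n)%:R =
    Num.sqrt (2 : R) / 32 * (3 - 2 * Num.sqrt 2) ^+ n
  + (7 - 5 * Num.sqrt 2) / 8 * n%:R * (3 - 2 * Num.sqrt 2) ^+ n
  - Num.sqrt (2 : R) / 32 * (3 + 2 * Num.sqrt 2) ^+ n
  + (7 + 5 * Num.sqrt 2) / 8 * n%:R * (3 + 2 * Num.sqrt 2) ^+ n.
Proof.
rewrite IDF_word_sum.
have := word_count_closed R.
set s := Num.sqrt 2; have s2 : s ^+ 2 = 2 by rewrite sqr_sqrtr // ler0n.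
move=> cnt; elim/ltn_ind: n => -[|[|n]] IH.
- by rewrite /word_sum unlock /= /cost unlock /=; field: s2.
- by rewrite /word_sum unlock /= /cost unlock /=; field: s2.
- have : (word_sum n.+2 cost)%:R + (word_sum n cost)%:R + 2 * (word_sum n (fun=> 1%N))%:R =
      6 * (word_sum n.+1 cost)%:R + 10 * (word_sum n.+1 (fun=> 1%N))%:R :> R.
    by rewrite -!natrM -!natrD word_cost_rec.
  rewrite (IH n) // (IH n.+1) // !cnt => /(canRL (addrK _))/(canRL (addrK _)) ->.
  by rewrite -[n.+2]addn2 -[n.+1]addn1 !natrD !exprD; field: s2.
Qed.
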